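(* Let $\mathbf{A}=(a_{i,j})$ be an $n\times n$ matrix in which every symbol occurs at most $k$ times. If $$k\le\frac{n-1}{4e}+1-\frac{1}{4n},$$ then $\mathbf{A}$ contains a Latin transversal.
   Context: A Latin transversal of an $n\times n$ matrix $\mathbf{A}=(a_{i,j})$ is a selection of $n$ entries, one from each row and each column, whose values are pairwise distinct; equivalently, a set of positions $\{(i,\pi(i)):1\le i\le n\}$, where $\pi$ is a permutation of $\{1,\ldots,n\}$, such that $a_{1,\pi(1)},\ldots,a_{n,\pi(n)}$ are pairwise distinct. The entries of the matrix (symbols) are elements of an arbitrary set. $e$ is the base of the natural logarithm. *)

(* Defs.v *)
From mathcomp Require Import all_boot all_order all_fingroup all_algebra.
From mathcomp Require Import boolp.

Set Implicit Arguments.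
Unset Strict Implicit.
Unset Printing Implicit Defensive.

(* Symbols range over an arbitrary type [T]; [asbool] supplies the classical
   decision of equality needed for counting. *)
Definition occurrences (T : Type) (n : nat) (A : 'M[T]_n) (s : T) : nat :=
  #|[pred p : 'I_n * 'I_n | `[< A p.1 p.2 = s >]]|.

(* The transversal is represented by the permutation [pi], that is, by the set
   of positions (i, pi i). *)
Definition latin_transversal (T : Type) (n : nat) (A : 'M[T]_n) (pi : 'S_n) :
    Prop :=
  injective (fun i : 'I_n => A i (pi i)).

(* Main.v *)
(** Take a uniformly random permutation. The bad events are that it passes
    through two given cells with equal symbols, each of probability
    [1 / (n (n - 1))]. Such an event is not independent of the pairs of cells
    avoiding its two rows and two columns, but conditioning on avoiding those
    pairs does not increase its probability, so the symmetric local lemma still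
    applies. Each bad pair shares a line with at most [d = 4 n (k - 1)] others,
    and the hypothesis on [k] is exactly [e (d + 1) <= n (n - 1)]. *)
Require Import Defs.

From mathcomp Require Import all_boot all_order all_fingroup all_algebra.
From mathcomp Require Import reals sequences exp.
From mathcomp Require Import boolp ring lra zify.

Set Implicit Arguments.
Unset Strict Implicit.

Import Order.TTheory GRing.Theory Num.Theory.
Local Open Scope ring_scope.

(** * The lopsided local lemma, by counting in a finite uniform space *)

Section LopsidedLocalLemma.
Variables (R : realFieldType) (W I : finType) (E : I -> {set W}).

Definition avoiding (S : {set I}) : {set W} :=
  [set w | [forall b in S, w \notin E b]].

Lemma avoidingP (S : {set I}) w :
  reflect (forall b, b \in S -> w \notin E b) (w \in avoiding S).
Proof. by rewrite inE; apply: forall_inP. Qed.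

Lemma avoiding0 : avoiding set0 = setT.
Proof. by apply/setP => w; rewrite in_setT; apply/avoidingP => b; rewrite inE. Qed.

Lemma avoidingS (S S' : {set I}) :
  S \subset S' -> avoiding S' \subset avoiding S.
Proof.
move=> /subsetP sSS'; apply/subsetP => w /avoidingP aw.
by apply/avoidingP => b /sSS'; apply: aw.
Qed.

Lemma avoidingU1 b (S : {set I}) : avoiding (b |: S) = avoiding S :\: E b.
Proof.
apply/setP => w; rewrite in_setD.
apply/avoidingP/andP => [aw | [wb /avoidingP aw] c].
  split; first by apply: aw; rewrite setU11.
  by apply/avoidingP => c Sc; apply: aw; rewrite setU1r.
by case/setU1P => [-> // | /aw].
Qed.

Lemma card_avoidingU1 b (S : {set I}) :
  #|avoiding (b |: S)|%:R = #|avoiding S|%:R - #|E b :&: avoiding S|%:R :> R.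
Proof.
by rewrite avoidingU1 -(cardsID (E b) (avoiding S)) setIC natrD addrC addKr.
Qed.

(** Chain rule: the events of [U] are added to [S] one at a time, each keeping at least a share
    [1 - x] of what is left. Asking the bound only for proper subsets [V] is what lets an induction
    on cardinality supply it. *)
Lemma avoiding_chain (x : R) (S U : {set I}) :
    0 <= x <= 1 -> [disjoint S & U] ->
    (forall (V : {set I}) u, u \in U -> V \proper S :|: U ->
       #|E u :&: avoiding V|%:R <= x * #|avoiding V|%:R) ->
  (1 - x) ^+ #|U| * #|avoiding S|%:R <= #|avoiding (S :|: U)|%:R.
Proof.
case/andP => x0 x1; have [m] := ubnP #|U|; elim: m U => // m IHm U leUm dSU hU.
have [->|[u Uu]] := set_0Vmem U.
  by rewrite cards0 expr0 mul1r setU0.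
have SUE : u |: (S :|: U :\ u) = S :|: U by rewrite setUCA setD1K.
have pr : S :|: U :\ u \proper S :|: U.
  rewrite -SUE properEneq subsetUr andbT; apply/eqP => e.
  have : u \in S :|: U :\ u by rewrite e setU11.
  by rewrite !inE eqxx orbF (disjointFl dSU Uu).
have dSU' : [disjoint S & U :\ u] by rewrite (disjointWr _ dSU) ?subD1set.
have := IHm (U :\ u) _ dSU'; rewrite -SUE card_avoidingU1 => IH.
have := hU _ u Uu pr; have {}IH : (1 - x) ^+ #|U :\ u| * #|avoiding S|%:R <=
    #|avoiding (S :|: U :\ u)|%:R.
  apply: IH => [|V v /setD1P[_ Uv] sV]; first by rewrite (cardsD1 u) Uu in leUm.
  exact: hU (proper_trans sV pr).
move=> hu; rewrite (cardsD1 u U) Uu exprS -mulrA.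
apply: (le_trans (ler_wpM2l _ IH)); first by rewrite subr_ge0.
by rewrite mulrBl mul1r lerB.
Qed.

Lemma lopsided_local_lemma (B : {set I}) (nb : rel I) (d : nat) (p x : R) :
    (0 < #|W|)%N -> 0 <= x < 1 -> p <= x * (1 - x) ^+ d ->
    {in B, forall b, #|[set s in B | nb b s]| <= d}%N ->
    (forall b (S : {set I}), b \in B -> S \subset B ->
       {in S, forall s, ~~ nb b s} ->
       #|E b :&: avoiding S|%:R <= p * #|avoiding S|%:R) ->
  exists w, w \in avoiding B.
Proof.
move=> W0 /andP[x0 x1] px nbd lop; have x01 : 0 <= x <= 1 by rewrite x0 ltW.
(* Conditional probability at most [x], in product form so that an empty condition needs no separate
   case. *)
have key (S : {set I}) b : b \in B -> S \subset B ->
    #|E b :&: avoiding S|%:R <= x * #|avoiding S|%:R.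
  have [m] := ubnP #|S|; elim: m S b => // m IHm S b leSm Bb sSB.
  (* [S1] holds the neighbours of [b]. The lopsided hypothesis bounds the numerator through [S2];
     passing from [S2] to [S] costs the denominator at most a factor [(1 - x) ^+ d], by induction
     along the chain. *)
  set S1 := [set s in S | nb b s]; set S2 := S :\: S1.
  have S12 : S2 :|: S1 = S.
    by apply/setP => s; rewrite !inE; case: (s \in S); case: (nb b s).
  have sS2 : S2 \subset S by apply: subsetDl.
  have chain : (1 - x) ^+ #|S1| * #|avoiding S2|%:R <= #|avoiding S|%:R.
    rewrite -S12; apply: avoiding_chain => //.
      by rewrite disjoints_subset; apply/subsetP => s; rewrite !inE => /andP[].
    move=> V u; rewrite S12 inE => /andP[Su _] pVS.
    apply: IHm; first exact: leq_trans (proper_card pVS) _.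
      exact: (subsetP sSB).
    exact: subset_trans (proper_sub pVS) sSB.
  have S1d : (#|S1| <= d)%N.
    apply: leq_trans (nbd b Bb); apply/subset_leq_card/subsetP => s.
    by rewrite !inE => /andP[/(subsetP sSB) -> ->].
  have hS2 : #|E b :&: avoiding S|%:R <= p * #|avoiding S2|%:R.
    apply: le_trans (lop b S2 Bb (subset_trans sS2 sSB) _).
      by rewrite ler_nat subset_leq_card // setIS // avoidingS.
    by move=> s; rewrite !inE; case: (s \in S); rewrite ?andbF ?andbT.
  apply: (le_trans hS2); apply: (le_trans (ler_wpM2r (ler0n _ _) px)).
  rewrite -mulrA ler_wpM2l //; apply: le_trans chain.
  by rewrite ler_wpM2r // ler_wiXn2l // ?lerBlDl ?lerDr ?subr_ge0 // ltW.
have := @avoiding_chain x set0 B x01; rewrite set0U avoiding0 cardsT => chain.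
have : 0 < #|avoiding B|%:R :> R.
  apply: lt_le_trans (chain _ _).
  - by rewrite mulr_gt0 ?exprn_gt0 ?ltr0n // subr_gt0.
  - by rewrite disjoints_subset sub0set.
  - by move=> V u Bu /proper_sub; apply: key.
by rewrite ltr0n => /card_gt0P.
Qed.

End LopsidedLocalLemma.

(** * Permutations through two given cells, and column shifts *)

Section Cells.
Variable n : nat.
Notation cell := ('I_n * 'I_n)%type.

Definition perms_through (b : cell * cell) : {set 'S_n} :=
  [set s : 'S_n | (s b.1.1 == b.1.2) && (s b.2.1 == b.2.2)].

Definition cross (b : cell * cell) : {set cell} :=
  setX [set b.1.1; b.2.1] setT :|: setX setT [set b.1.2; b.2.2].

Definition meets (b s : cell * cell) : bool :=
  (s.1 \in cross b) || (s.2 \in cross b).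

Lemma card_cross b : (#|cross b| <= 4 * n)%N.
Proof.
apply: leq_trans (leq_card_setU _ _).1 _; rewrite !cardsX cardsT card_ord !cards2.
by case: (_ != _); case: (_ != _); lia.
Qed.

Lemma card_distinct_pairs : #|[set y : cell | y.1 != y.2]| = (n * n.-1)%N.
Proof.
have -> : [set y : cell | y.1 != y.2] = ~: [set (i, i) | i in 'I_n].
  apply/setP => -[i j]; rewrite !inE /=; congr (~~ _).
  by apply/eqP/imsetP => [-> | [c _ [-> ->]]] //; exists j.
rewrite cardsCs setCK card_imset ?card_prod ?card_ord; last by move=> i j [].
nia.
Qed.

(** Meant to send [j] to [y.1] and [j'] to [y.2]. The inner [tperm j y.1 y.2] is the preimage of
    [y.2] under the transposition applied second. *)
Definition shift (j j' : 'I_n) (y : cell) : 'S_n :=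
  (tperm j' (tperm j y.1 y.2) * tperm j y.1)%g.

Lemma shift1 j j' y : j != j' -> y.1 != y.2 -> shift j j' y j = y.1.
Proof.
move=> jj' yy'; rewrite permM [tperm j' _ j]tpermD ?tpermL // 1?eq_sym //.
by rewrite -(inj_eq (@perm_inj _ (tperm j y.1))) tpermK tpermL.
Qed.

Lemma shift2 j j' y : shift j j' y j' = y.2.
Proof. by rewrite permM tpermL tpermK. Qed.

(** Both transpositions involve [j] or [j'], so any other column that moves can only land on one of
    these two. *)
Lemma shift_fix j j' y c : j != j' -> c \notin [set j; j'] ->
  shift j j' y c \notin [set j; j'] -> shift j j' y c = c.
Proof.
rewrite !inE !negb_or permM => jj' /andP[cj cj'].
case: (tpermP j' _ c) => [e|_|_ _]; first by rewrite e eqxx in cj'.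
  by case: tpermP => [e|_|_ _]; rewrite ?eqxx ?andbF //; rewrite e eqxx in jj'.
by case: tpermP => [e|_|//]; rewrite ?eqxx //; rewrite e eqxx in cj.
Qed.

(* Shifting the columns of a permutation through [b] only creates cells in the
   cross of [b], so it cannot create a pair in [S]; the shifts of the
   permutations through [b] are all distinct. *)
Lemma perms_through_lopsided b (S : {set cell * cell}) :
    b.1.1 != b.2.1 -> b.1.2 != b.2.2 -> {in S, forall s, ~~ meets b s} ->
  (#|perms_through b :&: avoiding perms_through S| * (n * n.-1)
     <= #|avoiding perms_through S|)%N.
Proof.
case: b => -[i j] [i' j'] /= ii' jj' hS.
(* The factor [n * n.-1] counts the targets [y] of a shift: ordered pairs of distinct columns. *)
rewrite -card_distinct_pairs -cardsX.
pose f (u : 'S_n * cell) := (u.1 * shift j j' u.2)%g.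
have fE u r : f u r = shift j j' u.2 (u.1 r) by apply: permM.
set D := setX _ _; have inD u : u \in D -> [/\ u.1 i = j, u.1 i' = j',
    u.1 \in avoiding perms_through S & u.2.1 != u.2.2].
  case: u => s y; rewrite in_setX in_setI => /andP[/andP[]].
  by rewrite !inE /= => /andP[/eqP ? /eqP ?].
(* The values of [f (s, y)] at rows [i] and [i'] are [y.1] and [y.2]; once [y] is known, the shift
   cancels. *)
have injf : {in D &, injective f}.
  move=> [s y] [t z] /inD[/= si si' _ yy] /inD[/= ti ti' _ zz] e.
  have ei := congr1 (fun g : 'S_n => g i) e; have ei' := congr1 (fun g : 'S_n => g i') e.
  move: ei ei'; rewrite !fE /= si si' ti ti' !shift1 // !shift2 => e1 e2.
  have yz : y = z by rewrite [y]surjective_pairing e1 e2 -surjective_pairing.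
  by move: e; rewrite /f /= yz => /mulIg ->.
rewrite -(card_in_imset injf).
apply/subset_leq_card/subsetP => _ /imsetP[[s y] /inD[/= si si' /avoidingP as_ yy] ->].
apply/avoidingP => c Sc; apply: contra (as_ c Sc).
(* Outside the cross, a cell of the shifted permutation was already a cell of [s]. *)
have back (u : cell) : u \notin cross ((i, j), (i', j')) ->
    f (s, y) u.1 == u.2 -> s u.1 == u.2.
  case: u => r q; rewrite fE !inE /= !andbT => /norP[/norP[ri ri'] /norP[qj qj']] /eqP sq.
  rewrite -sq shift_fix // ?sq ?inE ?negb_or; last by rewrite qj.
  by rewrite -{1}si -si' !(inj_eq perm_inj) ri.
have := hS c Sc; rewrite negb_or => /andP[h1 h2].
by rewrite !inE => /andP[/(back _ h1) -> /(back _ h2) ->].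
Qed.

End Cells.

(** * Pairs of cells with equal symbols, and their neighbours *)

Section Clashes.
Variables (T : Type) (n : nat) (A : 'M[T]_n).
Notation cell := ('I_n * 'I_n)%type.

(* Ordering the rows makes each unordered pair of cells appear once. *)
Definition clashes : {set cell * cell} :=
  [set q : cell * cell | [&& (q.1.1 < q.2.1)%N, q.1.2 != q.2.2 &
               `[< A q.1.1 q.1.2 = A q.2.1 q.2.2 >]]].

Lemma avoiding_clashes_latin s :
  s \in avoiding (@perms_through n) clashes -> latin_transversal A s.
Proof.
move=> /avoidingP av i i' /= e; apply/eqP/negPn/negP.
wlog lt_ii' : i i' e / (i < i')%N => [wl|] ii'.
  case: (ltngtP i i') => [lt|lt|/val_inj]; [exact: wl lt _|  | exact/eqP].
  by apply: wl (esym e) lt _; rewrite eq_sym.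
have := av ((i, s i), (i', s i')); rewrite !inE /= !eqxx /= lt_ii'.
by rewrite (inj_eq perm_inj) ii' /= => h; move: (h (asboolT e)).
Qed.

Lemma card_clashing_neighbours k b :
    (forall s : T, (occurrences A s <= k)%N) ->
  (#|[set s in clashes | meets b s]| <= 4 * n * k.-1)%N.
Proof.
move=> hA.
(* List a cell lying in the cross first: at most [4 * n] choices, then at most [k.-1] other cells
   with its symbol. The row order of clashes makes this reorientation injective. *)
pose f (s : cell * cell) := if s.1 \in cross b then s else (s.2, s.1).
have injf : {in [set s in clashes | meets b s] &, injective f}.
  move=> [u v] [u' v']; rewrite !inE /f /= => /andP[/and3P[l _ _] _].
  case/andP=> /and3P[l' _ _] _.
  case: ifP => _; case: ifP => _ [e1 e2]; subst=> //;
    by have := ltn_trans l l'; rewrite ltnn.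
rewrite -(card_in_imset injf).
pose same (u : cell) := [set v : cell | `[< A v.1 v.2 = A u.1 u.2 >]].
pose other u := same u :\ u.
have oth u : (#|other u| <= k.-1)%N.
  have : (#|same u| <= k)%N by rewrite cardsE; apply: hA.
  by rewrite (cardsD1 u) inE asboolT //; rewrite -/(other u); lia.
apply: (@leq_trans #|[set s : cell * cell | (s.1 \in cross b) && (s.2 \in other s.1)]|).
  apply/subset_leq_card/subsetP => w /imsetP[[u v]].
  rewrite !inE /= => /andP[/and3P[l _ /asboolP e] m] ->.
  have uv : u != v by apply: contraTneq l => ->; rewrite ltnn.
  move: m; rewrite /meets /f /=; case: ifP => /= [h _ | _ h].
    by rewrite !inE in h *; rewrite h /= eq_sym uv; apply/asboolP.
  by rewrite !inE in h *; rewrite h /= uv; apply/asboolP.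
rewrite -sum1_card (eq_bigl (fun s : cell * cell =>
  (s.1 \in cross b) && (s.2 \in other s.1))); last by move=> s; rewrite inE.
rewrite -(pair_big_dep (mem (cross b)) (fun u v => v \in other u) (fun _ _ => 1%N)) /=.
apply: (@leq_trans (\sum_(u in cross b) k.-1)).
  by apply: leq_sum => u _; rewrite sum1_card.
by rewrite sum_nat_const leq_mul2r card_cross orbT.
Qed.

End Clashes.

(** * Choice of the weight, and the conclusion *)

Lemma local_lemma_weight (R : realType) (d : nat) :
  ((d.+1%:R * expR 1)^-1 : R) <= d.+1%:R^-1 * (1 - d.+1%:R^-1) ^+ d.
Proof.
rewrite invfM ler_wpM2l ?invr_ge0 ?ler0n //.
case: d => [|d]; first by rewrite expr0 invf_le1 ?expR_gt0 // -[leLHS]expR0 ler_expR.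
have d0 : (d.+1%:R : R) != 0 by rewrite pnatr_eq0.
have d1 : (d.+2%:R : R) != 0 by rewrite pnatr_eq0.
(* This reduces the claim to [(1 + 1/m)^m <= e] with [m = d.+1]; the case of exponent 0, where [1/m]
   is meaningless, was settled above. *)
have -> : 1 - d.+2%:R^-1 = (1 + d.+1%:R^-1)^-1 :> R.
  have dE : d.+2%:R = d.+1%:R + 1 :> R by rewrite -[in LHS]addn1 natrD.
  by move: d0 d1; rewrite dE; move: d.+1%:R => y y0 y1; field; rewrite y0.
rewrite exprVn lef_pV2 ?posrE ?expR_gt0 ?exprn_gt0 ?addr_gt0 ?invr_gt0 ?ltr0n //.
have := @expR_ge1Dx R d.+1%:R^-1; move/(lerXn2r d.+1).
rewrite !nnegrE expR_ge0 addr_ge0 ?invr_ge0 ?ler0n // => /(_ isT isT) /le_trans; apply.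
by rewrite -expRM_natl mulfV.
Qed.

Theorem theorem23 (R : realType) (T : Type) (n k : nat) (A : 'M[T]_n)
    (hn : (0 < n)%N)
    (hA : forall s : T, (occurrences A s <= k)%N)
    (hk : (k%:R : R) <=
          (n%:R - 1) / (4 * expR 1) + 1 - 1 / (4 * n%:R)) :
  exists pi : 'S_n, latin_transversal A pi.
Proof.
have k0 : (0 < k)%N.
  pose i := Ordinal hn; apply: leq_trans (hA (A i i)).
  by apply/card_gt0P; exists (i, i); rewrite inE; apply/asboolP.
pose d := (4 * n * k.-1)%N.
have e0 := @expR_gt0 R 1; have n0 : (0 : R) < n%:R by rewrite ltr0n.
(* Multiply the hypothesis on [k], less 1, by [4 * n * e]. *)
have dn : d.+1%:R * expR 1 <= (n * n.-1)%:R :> R.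
  have kE : k%:R = k.-1%:R + 1 :> R by rewrite -[in LHS](prednK k0) -addn1 natrD.
  have nE : n%:R = n.-1%:R + 1 :> R by rewrite -[in LHS](prednK hn) -addn1 natrD.
  have h : k.-1%:R <= (n%:R - 1) / (4 * expR 1) - 1 / (4 * n%:R) :> R.
    by rewrite -(lerD2r 1) -kE addrAC.
  have pos : 0 <= 4 * n%:R * expR 1 :> R by rewrite !mulr_ge0 // ltW.
  have dE : d.+1%:R = 4 * n%:R * k.-1%:R + 1 :> R.
    by rewrite -[d.+1]addn1 natrD !natrM.
  have := ler_wpM2l pos h; rewrite dE natrM.
  have -> : 4 * n%:R * expR 1 * ((n%:R - 1) / (4 * expR 1) - 1 / (4 * n%:R)) =
            n%:R * (n%:R - 1) - expR 1 :> R.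
    by field; rewrite !gt_eqF.
  by have -> : n%:R - 1 = n.-1%:R :> R; [rewrite nE addrK | lra].
(* For [d = 0] the weight [1 / (d + 1)] would be 1, outside the range of the local lemma. But a
   clash meets its own cross, so there are no clashes and the identity works. *)
have [d_eq0|d_gt0] := posnP d.
  exists 1%g; apply: avoiding_clashes_latin; apply/avoidingP => b Bb.
  have := card_clashing_neighbours b hA; rewrite -/d d_eq0 leqn0 cards_eq0.
  by move/eqP/setP/(_ b); rewrite !inE in Bb *; rewrite Bb /meets !inE eqxx.
have d0 : (0 : R) < d.+1%:R by rewrite ltr0n.
have nn0 : (0 : R) < (n * n.-1)%:R.
  by apply: lt_le_trans dn; rewrite mulr_gt0.
have [] := @lopsided_local_lemma R _ _ (@perms_through n) (clashes A) (@meets n) d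
    (n * n.-1)%:R^-1 d.+1%:R^-1.
- by apply/card_gt0P; exists 1%g.
- by rewrite invr_ge0 ltW //= invf_lt1 // ltr1n.
- apply: le_trans (local_lemma_weight _ _).
  by rewrite lef_pV2 // posrE mulr_gt0.
- by move=> b _; apply: card_clashing_neighbours.
- move=> b S; rewrite inE => /and3P[lt jj' _] _ hS.
  rewrite mulrC ler_pdivlMr // -natrM ler_nat.
  by apply: perms_through_lopsided => //; apply: contraTneq lt => ->; rewrite ltnn.
- by move=> s /avoiding_clashes_latin; exists s.
Qed.
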